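(* Let $(A,\cdot_A,\Delta_r,\Phi=\{\partial_k\}_{k=1}^m,\Psi=\{\eth_k\}_{k=1}^m)$ be a factorizable differential ASI bialgebra with $I_r=r_+-r_-$, and let $\lambda\in\mathbb K$, $\lambda\ne0$. Define a linear map $P:A\to A$ and a bilinear form $\mathfrak B$ on $A$ by $$P=-\lambda\,r_+\circ I_r^{-1},\qquad \mathfrak B(a,b)=-\lambda\langle I_r^{-1}(a),b\rangle,\quad a,b\in A.$$ Then $((A,\cdot_A,\Phi),\mathfrak B,P)$ is a symmetric Rota-Baxter differential Frobenius algebra of weight $\lambda$ such that the adjoint of $\Phi$ with respect to $\mathfrak B$ is $\Psi$, i.e. $\mathfrak B(\partial_k(a),b)=\mathfrak B(a,\eth_k(b))$ for all $a,b\in A$ and all $k$.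
   Context: All vector spaces are finite-dimensional over a field $\mathbb K$ of characteristic $0$; associative algebras need not be unital or commutative. $L(a)b=a\cdot_A b=R(b)a$; $\tau$ is the flip. Differential algebra $(A,\cdot_A,\Phi=\{\partial_k\}_{k=1}^m)$: an associative algebra with finitely many pairwise commuting derivations. For a family $\Psi=\{\eth_k:A\to A\}_{k=1}^m$ of pairwise commuting linear maps, $(A,\cdot_A,\Phi)$ is $\Psi$-admissible if for all $a,b\in A$ and all $k$: $\eth_k(a)\cdot_A b=a\cdot_A\partial_k(b)+\eth_k(a\cdot_A b)$ and $a\cdot_A\eth_k(b)=\partial_k(a)\cdot_A b+\eth_k(a\cdot_A b)$. For $r=\sum_i a_i\otimes b_i\in A\otimes A$, $r$ is a solution of the $\Psi$-admissible associative Yang-Baxter equation (AYBE) in $(A,\cdot_A,\Phi)$ if $\sum_{i,j}(a_i\cdot_A a_j\otimes b_i\otimes b_j+a_i\otimes a_j\otimes b_i\cdot_A b_j-a_i\otimes a_j\cdot_A b_i\otimes b_j)=0$ and $(\partial_k\otimes\mathrm{id}-\mathrm{id}\otimes\eth_k)(r)=0$, $(\eth_k\otimes\mathrm{id}-\mathrm{id}\otimes\partial_k)(r)=0$ for all $k$. A tensor $s\in A\otimes A$ is $L$-invariant if $(L(a)\otimes\mathrm{id}-\mathrm{id}\otimes R(a))(s)=0$ for all $a\in A$. Put $\Delta_r(a)=(\mathrm{id}\otimes L(a)-R(a)\otimes\mathrm{id})(r)$. If $(A,\cdot_A,\Phi)$ is a $\Psi$-admissible differential algebra, $r$ solves the $\Psi$-admissible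 AYBE in it and the symmetric part $\frac12(r+\tau(r))$ of $r$ is $L$-invariant, then $(A,\cdot_A,\Delta_r,\Phi,\Psi)$ is a differential antisymmetric infinitesimal (ASI) bialgebra (known), called a quasi-triangular differential ASI bialgebra. It is factorizable if the symmetric part of $r$ is nondegenerate, i.e. $I_r=r_+-r_-:A^*\to A$ is a linear isomorphism, where $r_\pm:A^*\to A$ are defined by $\langle r_+(x^* ),y^*\rangle=-\langle x^*,r_-(y^* )\rangle=\langle r,x^*\otimes y^*\rangle$. Symmetric Rota-Baxter differential Frobenius algebra of weight $\lambda$, $((A,\cdot_A,\Phi),\mathfrak B,P)$: $(A,\cdot_A,\Phi)$ is a differential algebra, $\mathfrak B$ is a nondegenerate symmetric bilinear form with $\mathfrak B(a\cdot_A b,c)=\mathfrak B(a,b\cdot_A c)$, and $P:A\to A$ is linear with $P(a)\cdot_A P(b)=P(P(a)\cdot_A b+a\cdot_A P(b)+\lambda a\cdot_A b)$, $\mathfrak B(a,P(b))+\mathfrak B(P(a),b)+\lambda\mathfrak B(a,b)=0$, and $\partial_kP=P\partial_k$ for all $k$. The adjoint of $\Phi$ with respect to $\mathfrak B$ is $\hat\Phi=\{\hat\partial_k\}$ with $\mathfrak B(\partial_k(a),b)=\mathfrak B(a,\hat\partial_k(b))$. *)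

(* Defs.v *)
From HB Require Import structures.
From mathcomp Require Import all_boot all_order all_algebra.

Set Implicit Arguments.
Unset Strict Implicit.
Unset Printing Implicit Defensive.

Import GRing.Theory.
Local Open Scope ring_scope.

Definition dual (K : fieldType) (U : vectType K) : vectType K := 'Hom(U, K^o).

Section Tensor.
Variable K : fieldType.
Implicit Types U V W : vectType K.

(* The tensor product is modelled on coordinates in the bases vbasis fullv.
   It does not depend on this choice: tens_bilinear, tlift_tens and tlift_uniq
   below are its universal property. *)
Definition tensor U V : vectType K := 'M[K]_(\dim {:U}, \dim {:V}).

Definition tens U V (u : U) (v : V) : tensor U V :=
  \matrix_(i, j) (coord (vbasis {:U}) i u * coord (vbasis {:V}) j v).

(* tlift f maps \sum_i a_i (x) b_i to \sum_i f a_i b_i when f is bilinear: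
   see tlift_sum. *)
Definition tlift U V W (f : U -> V -> W) (t : tensor U V) : W :=
  \sum_i \sum_j (t : 'M_(_, _)) i j *: f (vbasis {:U})`_i (vbasis {:V})`_j.

Definition tmap U V U' V' (f : U -> U') (g : V -> V') :
    tensor U V -> tensor U' V' :=
  tlift (fun u v => tens (f u) (g v)).

Definition tflip U V : tensor U V -> tensor V U :=
  tlift (fun u v => tens v u).

Definition tpair U V (t : tensor U V) (x : dual U) (y : dual V) : K :=
  tlift (W := K^o) (fun u v => x u * y v) t.

Lemma tens_bilinear U V : bilinear_for *:%R *:%R (@tens U V).
Proof.
split=> [v k u u' | u k v v']; apply/matrixP=> i j; rewrite !mxE linearP /=.
  by rewrite mulrDl mulrA.
by rewrite mulrDr mulrCA.
Qed.

Lemma tlift_linear U V W (f : U -> V -> W) : linear (tlift f).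
Proof.
move=> k s t; rewrite /tlift scaler_sumr -big_split; apply: eq_bigr => i _.
rewrite scaler_sumr -big_split; apply: eq_bigr => j _ /=.
by rewrite !mxE scalerDl scalerA.
Qed.

Lemma tlift_tens U V W (f : U -> V -> W) u v :
  bilinear_for *:%R *:%R f -> tlift f (tens u v) = f u v.
Proof.
move=> flin.
pose F : {bilinear U -> V -> W} :=
  HB.pack f (bilinear_isBilinear.Build _ _ _ _ _ _ _ flin).
change (tlift F (tens u v) = F u v).
rewrite [in RHS](coord_vbasis (memvf u)) linear_sumlz; apply: eq_bigr => i _.
rewrite linearZl_LR [in RHS](coord_vbasis (memvf v)) linear_sumr scaler_sumr.
by apply: eq_bigr => j _; rewrite linearZr_LR !mxE scalerA.
Qed.

Lemma tlift_sum U V W (f : U -> V -> W) n (a : 'I_n -> U) (b : 'I_n -> V) :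
  bilinear_for *:%R *:%R f ->
  tlift f (\sum_i tens (a i) (b i)) = \sum_i f (a i) (b i).
Proof.
move=> flin.
pose F := HB.pack (tlift f) (GRing.isLinear.Build _ _ _ _ _ (tlift_linear f))
  : {linear tensor U V -> W}.
change (F (\sum_i tens (a i) (b i)) = \sum_i f (a i) (b i)).
by rewrite linear_sum; apply: eq_bigr => i _; apply: tlift_tens.
Qed.

Lemma tensor_expand U V (t : tensor U V) :
  t = \sum_i \sum_j (t : 'M_(_, _)) i j
        *: tens (vbasis {:U})`_i (vbasis {:V})`_j.
Proof.
apply/matrixP=> k l; rewrite summxE (bigD1 k) //= summxE (bigD1 l) //=.
rewrite !mxE !coord_free ?(basis_free (vbasisP _)) // !eqxx !mulr1.
rewrite !big1 ?addr0 // => [i nki | j nlj].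
  rewrite summxE big1 // => j _.
  rewrite !mxE !coord_free ?(basis_free (vbasisP _)) //.
  by rewrite (negPf nki) mul0r mulr0.
rewrite !mxE !coord_free ?(basis_free (vbasisP _)) //.
by rewrite (negPf nlj) !mulr0.
Qed.

Lemma tlift_uniq U V W (f : U -> V -> W) (g : {linear tensor U V -> W}) :
  (forall u v, g (tens u v) = f u v) -> g =1 tlift f.
Proof.
move=> gE t; rewrite {1}[t]tensor_expand linear_sum; apply: eq_bigr => i _.
by rewrite linear_sum; apply: eq_bigr => j _; rewrite linearZ gE.
Qed.

End Tensor.

Section RMaps.
Variables (K : fieldType) (A : vectType K).
Implicit Types (r : tensor A A) (x y : dual A).

(* For r = \sum_i a_i (x) b_i, r_+(x) = \sum_i x(a_i) b_i and
   r_-(x) = - \sum_i x(b_i) a_i; their characterization by the duality pairing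
   is r_plusP and r_minusP. *)
Definition r_plus r : 'Hom(dual A, A) :=
  linfun (fun x : dual A => tlift (fun a b => x a *: b) r).

Definition r_minus r : 'Hom(dual A, A) :=
  linfun (fun x : dual A => - tlift (fun a b => x b *: a) r).

Definition I_map r : 'Hom(dual A, A) := r_plus r - r_minus r.

Lemma r_plusE r x : r_plus r x = tlift (fun a b => x a *: b) r.
Proof.
have lin : linear (fun z : dual A => tlift (fun a b : A => z a *: b) r).
  move=> k y z; rewrite /tlift scaler_sumr -big_split; apply: eq_bigr => i _.
  rewrite scaler_sumr -big_split; apply: eq_bigr => j _ /=.
  by rewrite add_lfunE scale_lfunE scalerDl scalerDr !scalerA mulrCA mulrA.
pose F := HB.pack (fun z : dual A => tlift (fun a b : A => z a *: b) r)
  (GRing.isLinear.Build _ _ _ _ _ lin) : {linear dual A -> A}.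
exact: (lfunE F x).
Qed.

Lemma r_minusE r x : r_minus r x = - tlift (fun a b => x b *: a) r.
Proof.
have lin : linear (fun z : dual A => - tlift (fun a b : A => z b *: a) r).
  move=> k y z; rewrite scalerN -opprD; congr (- _).
  rewrite /tlift scaler_sumr -big_split; apply: eq_bigr => i _.
  rewrite scaler_sumr -big_split; apply: eq_bigr => j _ /=.
  by rewrite add_lfunE scale_lfunE scalerDl scalerDr !scalerA mulrCA mulrA.
pose F := HB.pack (fun z : dual A => - tlift (fun a b : A => z b *: a) r)
  (GRing.isLinear.Build _ _ _ _ _ lin) : {linear dual A -> A}.
exact: (lfunE F x).
Qed.

Lemma r_plusP r x y : y (r_plus r x) = tpair r x y.
Proof.
rewrite r_plusE linear_sum; apply: eq_bigr => i _.
rewrite linear_sum; apply: eq_bigr => j _; rewrite linearZ; congr (_ *: _).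
by rewrite linearZ.
Qed.

Lemma r_minusP r x y : - x (r_minus r y) = tpair r x y.
Proof.
rewrite r_minusE linearN opprK linear_sum; apply: eq_bigr => i _.
rewrite linear_sum; apply: eq_bigr => j _; rewrite linearZ; congr (_ *: _).
by rewrite linearZ mulrC.
Qed.

End RMaps.

Section DifferentialASI.
Variables (K : fieldType) (A : vectType K) (mul : A -> A -> A).
Variables (m : nat) (Phi Psi : 'I_m -> 'End(A)).

Record diff_algebra : Prop := DiffAlgebra {
  da_bilinear : bilinear_for *:%R *:%R mul;
  da_assoc : associative mul;
  da_derivation : forall k a b,
    Phi k (mul a b) = mul (Phi k a) b + mul a (Phi k b);
  da_commute : forall k l a, Phi k (Phi l a) = Phi l (Phi k a)
}.

Record admissible_diff_algebra : Prop := AdmissibleDiffAlgebra {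
  ad_diff : diff_algebra;
  ad_commute : forall k l a, Psi k (Psi l a) = Psi l (Psi k a);
  ad_left : forall k a b,
    mul (Psi k a) b = mul a (Phi k b) + Psi k (mul a b);
  ad_right : forall k a b,
    mul a (Psi k b) = mul (Phi k a) b + Psi k (mul a b)
}.

(* The double tlift is the double sum over two copies
   \sum_i a (x) b and \sum_j a' (x) b' of r. *)
Definition AYBE (r : tensor A A) : Prop :=
  tlift (fun a b => tlift (fun a' b' =>
      tens (mul a a') (tens b b') + tens a (tens a' (mul b b'))
      - tens a (tens (mul a' b) b')) r) r
  = 0 :> tensor A (tensor A A).

Record admissible_AYBE (r : tensor A A) : Prop := AdmissibleAYBE {
  ay_AYBE : AYBE r;
  ay_PhiPsi : forall k, tmap (Phi k) idfun r - tmap idfun (Psi k) r = 0;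
  ay_PsiPhi : forall k, tmap (Psi k) idfun r - tmap idfun (Phi k) r = 0
}.

Definition L_invariant (s : tensor A A) : Prop :=
  forall a, tmap (mul a) idfun s - tmap idfun (mul^~ a) s = 0.

Definition sym_part (r : tensor A A) : tensor A A := 2^-1 *: (r + tflip r).

Definition coprod (r : tensor A A) (a : A) : tensor A A :=
  tmap idfun (mul a) r - tmap (mul^~ a) idfun r.

Record quasi_triangular_diff_ASI (Delta : A -> tensor A A) (r : tensor A A) :
    Prop := QuasiTriangularDiffASI {
  qt_admissible : admissible_diff_algebra;
  qt_AYBE : admissible_AYBE r;
  qt_invariant : L_invariant (sym_part r);
  qt_coprod : Delta =1 coprod r
}.

Record factorizable_diff_ASI (Delta : A -> tensor A A) (r : tensor A A) :
    Prop := FactorizableDiffASI {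
  fa_quasi_triangular : quasi_triangular_diff_ASI Delta r;
  fa_iso : bijective (I_map r)
}.

Record sym_RB_diff_Frobenius (B : A -> A -> K) (P : 'End(A)) (lambda : K) :
    Prop := SymRBDiffFrobenius {
  fr_diff : diff_algebra;
  fr_bilinear : bilinear_for *%R *%R B;
  fr_nondegenerate_l : forall a, (forall b, B a b = 0) -> a = 0;
  fr_nondegenerate_r : forall b, (forall a, B a b = 0) -> b = 0;
  fr_symmetric : forall a b, B a b = B b a;
  fr_invariant : forall a b c, B (mul a b) c = B a (mul b c);
  fr_RotaBaxter : forall a b,
    mul (P a) (P b) = P (mul (P a) b + mul a (P b) + lambda *: mul a b);
  fr_compatible : forall a b, B a (P b) + B (P a) b + lambda * B a b = 0;
  fr_commute : forall k a, Phi k (P a) = P (Phi k a)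
}.

Definition is_adjoint_family (B : A -> A -> K) : Prop :=
  forall k a b, B (Phi k a) b = B a (Psi k b).

End DifferentialASI.

(* Main.v *)
(** Write p = r_+, n = r_-, I = p - n and J = I^-1.  Since n is minus the
transpose of p, I is symmetric, and L-invariance of the symmetric part of r says
I(x o L(a)) = I(x) a, hence also I(x o R(a)) = a I(x); this gives the symmetry
and invariance of B.  Contracting the AYBE with x and y in its first two legs
yields p(x) p(y) = p(x o L(n(y)) + y o R(p(x))), which under x = J(a), y = J(b)
is the Rota-Baxter identity, as b = p(y) - n(y).  The conditions relating r to
the derivations say that p and I intertwine precomposition with Psi k and Phi k,
whence P commutes with Phi k and Psi k is adjoint to Phi k. *)
From HB Require Import structures.
Require Import Defs.
From mathcomp Require Import all_boot all_order all_algebra.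
From mathcomp Require Import ring.
Import GRing.Theory.
Local Open Scope ring_scope.

(** * Calculus of maps lifted to the tensor product *)

Section TensorLift.
Context {K : fieldType}.
Implicit Types U V W : vectType K.

Lemma eq_tlift {U V W} (f g : U -> V -> W) (t : tensor U V) :
  (forall u v, f u v = g u v) -> tlift f t = tlift g t.
Proof.
by move=> fg; apply: eq_bigr => i _; apply: eq_bigr => j _; rewrite fg.
Qed.

Lemma linear_tlift {U V W W'} (h : W -> W') (f : U -> V -> W) (t : tensor U V) :
  linear h -> h (tlift f t) = tlift (fun u v => h (f u v)) t.
Proof.
move=> hlin.
pose H := HB.pack h (GRing.isLinear.Build _ _ _ _ _ hlin) : {linear W -> W'}.
change (H (tlift f t) = tlift (fun u v => H (f u v)) t).
rewrite linear_sum; apply: eq_bigr => i _.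
by rewrite linear_sum; apply: eq_bigr => j _; rewrite linearZ.
Qed.

Lemma tliftD {U V W} (f g : U -> V -> W) (t : tensor U V) :
  tlift (fun u v => f u v + g u v) t = tlift f t + tlift g t.
Proof.
rewrite -big_split; apply: eq_bigr => i _.
by rewrite -big_split; apply: eq_bigr => j _; rewrite scalerDr.
Qed.

Lemma tliftN {U V W} (f : U -> V -> W) (t : tensor U V) :
  tlift (fun u v => - f u v) t = - tlift f t.
Proof.
rewrite -sumrN; apply: eq_bigr => i _.
by rewrite -sumrN; apply: eq_bigr => j _; rewrite scalerN.
Qed.

Lemma tliftZ {U V W} k (f : U -> V -> W) (t : tensor U V) :
  tlift (fun u v => k *: f u v) t = k *: tlift f t.
Proof. by rewrite (linear_tlift ( *:%R k)) //; apply: linearP. Qed.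

Lemma tlift_tmap {U V U' V' W} (G : U' -> V' -> W) (f : U -> U') (g : V -> V')
    (t : tensor U V) :
  bilinear_for *:%R *:%R G ->
  tlift G (tmap f g t) = tlift (fun u v => G (f u) (g v)) t.
Proof.
move=> Glin; rewrite (linear_tlift _ _ _ (tlift_linear G)).
by apply: eq_tlift => u v; rewrite tlift_tens.
Qed.

Lemma contract_bilinear {U V} (x : dual U) :
  bilinear_for *:%R *:%R (fun (a : U) (b : V) => x a *: b).
Proof.
split=> [v k u u' | u k v v'] /=; last by rewrite linearP.
by rewrite linearP scalerDl scalerA.
Qed.

End TensorLift.

(** * Contractions of a tensor with functionals *)

Section Quasitriangular.
Context {K : fieldType} {A : vectType K}.
Implicit Types (r : tensor A A) (x y : dual A) (f g : 'End(A)) (a b c : A).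

Local Notation "x '\c' f" := (comp_lfun (x : 'Hom(A, K^o)) f : dual A)
  (at level 50).

Lemma r_plus_tmap r f g x : r_plus (tmap f g r) x = g (r_plus r (x \c f)).
Proof.
rewrite !r_plusE tlift_tmap; last exact: contract_bilinear.
rewrite (linear_tlift (g : A -> A) _ _ (linearP g)); apply: eq_tlift => a b.
by rewrite linearZ comp_lfunE.
Qed.

Lemma r_plus_flip r x : r_plus (tflip r) x = - r_minus r x.
Proof.
rewrite r_minusE opprK r_plusE (linear_tlift _ _ _ (tlift_linear _)).
by apply: eq_tlift => a b; rewrite tlift_tens //; apply: contract_bilinear.
Qed.

Lemma r_plus_linear x : linear (fun r => r_plus r x).
Proof. by move=> k s t; rewrite !r_plusE tlift_linear. Qed.

Lemma r_plusB r s x : r_plus (r - s) x = r_plus r x - r_plus s x.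
Proof. by rewrite addrC -scaleN1r r_plus_linear scaleN1r addrC. Qed.

Lemma I_mapE r x : I_map r x = r_plus r x - r_minus r x.
Proof. by rewrite add_lfunE opp_lfunE. Qed.

Lemma r_minus_adjoint r x y : x (r_minus r y) = - y (r_plus r x).
Proof. by rewrite r_plusP -r_minusP opprK. Qed.

Lemma I_map_symmetric r x y : y (I_map r x) = x (I_map r y).
Proof. by rewrite !I_mapE !linearB /= !r_minus_adjoint !opprK addrC. Qed.

(** The coordinate functionals of a basis already separate points. *)
Lemma dual_sep a b : (forall x, x a = x b) -> a = b.
Proof.
move=> xab; rewrite (coord_vbasis (memvf a)) (coord_vbasis (memvf b)).
apply: eq_bigr => i _; congr (_ *: _).
by have := xab (linfun (coord (vbasis {:A}) i : A -> K^o)); rewrite !lfunE.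
Qed.

(** Contracting the hypothesis with [x] turns a map on the first leg into precomposition of [x] and
    a map on the second leg into postcomposition. *)
Lemma r_plus_intertwine r f g :
  tmap f idfun r - tmap idfun g r = 0 ->
  forall x, r_plus r (x \c f) = g (r_plus r x).
Proof.
move=> rfg x; apply/eqP; rewrite -subr_eq0; apply/eqP.
(* [r_plus_tmap] takes bundled endomorphisms, so [idfun] is traded for the linear identity. *)
have tid : forall f', tmap f' (idfun : A -> A) r = tmap f' (\1%VF : 'End(A)) r
                  /\ tmap (idfun : A -> A) f' r = tmap (\1%VF : 'End(A)) f' r.
  by move=> f'; split; apply: eq_tlift => a b; rewrite id_lfunE.
have := congr1 (fun s => r_plus s x) rfg.
rewrite r_plusB (tid f).1 (tid g).2 !r_plus_tmap id_lfunE.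
rewrite comp_lfun1r => ->; rewrite r_plusE /tlift big1 // => i _.
by rewrite big1 // => j _; rewrite mxE scale0r.
Qed.

(** The first condition handles [r_plus]. Since [r_minus] is minus its transpose, the condition with
    [f] and [g] exchanged handles [r_minus]. *)
Lemma I_map_intertwine r f g :
  tmap f idfun r - tmap idfun g r = 0 ->
  tmap g idfun r - tmap idfun f r = 0 ->
  forall x, I_map r (x \c f) = g (I_map r x).
Proof.
move=> rfg rgf x; apply: dual_sep => y.
rewrite !I_mapE !linearB /= (r_plus_intertwine _ _ _ rfg) r_minus_adjoint.
have -> : y (g (r_minus r x)) = (y \c g) (r_minus r x) by rewrite comp_lfunE.
rewrite r_minus_adjoint (r_plus_intertwine _ _ _ rgf).
by rewrite comp_lfunE.
Qed.

(** * Invariance and the Yang-Baxter equation as identities for [I_map] and [r_plus] *)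

Section Multiplication.
Context {mul : A -> A -> A} (mul_bilin : bilinear_for *:%R *:%R mul).

(** [linfun] agrees with its argument only when that is linear, so evaluating [lmul] and [rmul]
    requires bilinearity of [mul]. *)
Definition lmul a : 'End(A) := linfun (mul a).
Definition rmul a : 'End(A) := linfun (mul^~ a).

Lemma lmulE a b : lmul a b = mul a b.
Proof.
pose F := HB.pack (mul a) (GRing.isLinear.Build _ _ _ _ _ (mul_bilin.2 a))
  : {linear A -> A}.
exact: (lfunE F b).
Qed.

Lemma rmulE a b : rmul a b = mul b a.
Proof.
pose F := HB.pack (mul^~ a) (GRing.isLinear.Build _ _ _ _ _ (mul_bilin.1 a))
  : {linear A -> A}.
exact: (lfunE F b).
Qed.

(** On the symmetric part [r_plus] is half of [I_map r], and L-invariance is the hypothesis of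
    [r_plus_intertwine] for [lmul a] and [rmul a]. *)
Lemma L_invariant_I_map r : 2 != 0 :> K -> L_invariant mul (sym_part r) ->
  forall x a, I_map r (x \c lmul a) = mul (I_map r x) a.
Proof.
move=> nz2 inv x a.
have I_sym z : r_plus (sym_part r) z = 2^-1 *: I_map r z.
  (* A zero summand gives the term the shape [k *: s + t] that [r_plus_linear] expects. *)
  rewrite /sym_part -[_ *: _]addr0 r_plus_linear -[X in X + tflip r]scale1r.
  rewrite r_plus_linear scale1r r_plus_flip -I_mapE -[RHS]addr0; congr (_ + _).
  by rewrite -(subrr r) r_plusB subrr.
have s_inv : tmap (lmul a) idfun (sym_part r)
           - tmap idfun (rmul a) (sym_part r) = 0.
  rewrite -(inv a); congr (_ - _); apply: eq_tlift => u v.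
    by rewrite lmulE.
  by rewrite rmulE.
have := r_plus_intertwine _ _ _ s_inv x; rewrite !I_sym linearZ /= rmulE.
by apply: scalerI; rewrite invr_eq0.
Qed.

(** This is the transpose of the hypothesis, because [I_map r] is symmetric. *)
Lemma I_map_rmul r :
  (forall x a, I_map r (x \c lmul a) = mul (I_map r x) a) ->
  forall x a, I_map r (x \c rmul a) = mul a (I_map r x).
Proof.
move=> inv x a; apply: dual_sep => y.
rewrite I_map_symmetric comp_lfunE rmulE -inv I_map_symmetric.
by rewrite comp_lfunE lmulE.
Qed.

(* Contract the AYBE with [x] and [y] in its first two legs. *)
Lemma AYBE_r_plus r : AYBE mul r -> forall x y,
  mul (r_plus r x) (r_plus r y)
  = r_plus r ((x \c lmul (r_minus r y)) + (y \c rmul (r_plus r x))).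
Proof.
move=> aybe x y.
(* [C] applies [x] to the first leg, [y] to the second, and keeps the third. *)
pose C := tlift (fun a (s : tensor A A) => x a *: tlift (fun b c => y b *: c) s).
have C_lin : linear C := tlift_linear _.
have CE a b c : C (tens a (tens b c)) = x a *: (y b *: c).
  rewrite /C tlift_tens ?tlift_tens //; first exact: contract_bilinear.
  split=> [s k u u' | u k s s'] /=; first by rewrite linearP scalerDl scalerA.
  by rewrite tlift_linear scalerDr !scalerA mulrC.
have CD s t : C (s + t) = C s + C t.
  by rewrite -[s in LHS]scale1r C_lin scale1r.
have CN s : C (- s) = - C s.
  by rewrite -scaleN1r (GRing.scalable_linear C_lin) /= scaleN1r.
have C0 : C 0 = 0 by rewrite -(subrr 0) CD CN subrr.
have mulZr a k b : mul a (k *: b) = k *: mul a b by rewrite -!lmulE linearZ.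
have := congr1 C aybe; rewrite C0 (linear_tlift _ _ _ C_lin).
(* Only the inner copy of [r] is summed here; the component [a], [b] of the outer copy stays
   fixed. *)
have inner a b : C (tlift (fun a' b' =>
      tens (mul a a') (tens b b') + tens a (tens a' (mul b b'))
      - tens a (tens (mul a' b) b')) r)
   = y b *: r_plus r (x \c lmul a) + x a *: mul b (r_plus r y)
     - x a *: r_plus r (y \c rmul b).
  rewrite (linear_tlift _ _ _ C_lin) !r_plusE.
  rewrite (linear_tlift (mul b) _ _ (mul_bilin.2 b)).
  rewrite -!(@tliftZ K) -tliftN -!tliftD.
  apply: eq_tlift => a' b'.
  by rewrite !CD CN !CE !comp_lfunE lmulE rmulE mulZr !scalerA [y b * _]mulrC.
rewrite (eq_tlift _ _ _ inner) !tliftD tliftN.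
(* Linearity in the multiplier lets the outer sum move inside [lmul] and [rmul]. *)
have Lp_lin : linear (fun a => r_plus r (x \c lmul a)).
  move=> k a b; rewrite -linearP; congr (r_plus r _).
  apply/lfunP => c; rewrite !(add_lfunE, scale_lfunE, comp_lfunE) !lmulE.
  by rewrite (mul_bilin.1 c) linearP.
have Rp_lin : linear (fun a => r_plus r (y \c rmul a)).
  move=> k a b; rewrite -linearP; congr (r_plus r _).
  apply/lfunP => c; rewrite !(add_lfunE, scale_lfunE, comp_lfunE) !rmulE.
  by rewrite (mul_bilin.2 c) linearP.
(* The sign appears because contracting the second leg with [y] gives [- r_minus r y]. *)
have -> : tlift (fun a b => y b *: r_plus r (x \c lmul a)) r
        = - r_plus r (x \c lmul (r_minus r y)).
  rewrite r_minusE -[- tlift _ _]scaleN1r (GRing.scalable_linear Lp_lin).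
  rewrite /= scaleN1r opprK (linear_tlift _ _ _ Lp_lin).
  by apply: eq_tlift => a b; rewrite (GRing.scalable_linear Lp_lin).
have -> : tlift (fun a b => x a *: mul b (r_plus r y)) r
        = mul (r_plus r x) (r_plus r y).
  rewrite [r_plus r x]r_plusE.
  rewrite (linear_tlift _ _ _ (mul_bilin.1 (r_plus r y))).
  by apply: eq_tlift => a b; rewrite -!rmulE linearZ.
have -> : tlift (fun a b => x a *: r_plus r (y \c rmul b)) r
        = r_plus r (y \c rmul (r_plus r x)).
  rewrite [in RHS](r_plusE r x) (linear_tlift _ _ _ Rp_lin).
  by apply: eq_tlift => a b; rewrite (GRing.scalable_linear Rp_lin).
move/eqP; rewrite linearD subr_eq0 addrC subr_eq => /eqP ->.
by rewrite addrC.
Qed.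

End Multiplication.

Section Factorization.
Context {r : tensor A A} (I_bij : bijective (I_map r)).

Lemma lker_I_map : lker (I_map r) == 0%VS.
Proof. exact/lker0P/(bij_inj I_bij). Qed.

Lemma I_mapK : cancel (I_map r) (I_map r)^-1%VF.
Proof. exact: (lker0_lfunK lker_I_map). Qed.

(** Injectivity makes the inverse a left inverse; writing [a] as an image under [I_map r] makes it a
    right inverse too. *)
Lemma I_mapVK : cancel (I_map r)^-1%VF (I_map r).
Proof. by case: I_bij => g _ Ig a; rewrite -[a]Ig I_mapK. Qed.

End Factorization.

End Quasitriangular.

Theorem theorem5p18 (K : fieldType) (charK0 : [pchar K] =i pred0)
    (A : vectType K) (mul : A -> A -> A) (m : nat)
    (Phi Psi : 'I_m -> 'End(A)) (r : tensor A A) (lambda : K) :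
  factorizable_diff_ASI mul Phi Psi (coprod mul r) r ->
  lambda != 0 ->
  let P : 'End(A) := (- lambda) *: (r_plus r \o (I_map r)^-1)%VF in
  let B : A -> A -> K := fun a b => - lambda * ((I_map r)^-1%VF a) b in
  sym_RB_diff_Frobenius mul Phi B P lambda /\ is_adjoint_family Phi Psi B.
Proof.
move=> [[[da _ _ _] [aybe PhiPsi PsiPhi] inv _] I_bij] nz_l P B.
have [mul_bilin _ _ _] := da.
(* Characteristic zero enters here, to cancel the factor 1/2 of the symmetric part. *)
have nz2 : 2 != 0 :> K by have := charK0 2; rewrite !inE /= => ->.
pose J := (I_map r)^-1%VF.
have JK : cancel J (I_map r) := I_mapVK I_bij.
have IK : cancel (I_map r) J := I_mapK I_bij.
have IL := L_invariant_I_map mul_bilin r nz2 inv.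
have IR := I_map_rmul mul_bilin r IL.
have Jsym a b : J a b = J b a.
  by rewrite -{1}[b]JK I_map_symmetric JK.
(* [Jl] and [Jr] say that [J] is a bimodule map from [A] to its dual. *)
have Jl x b : J (mul (I_map r x) b) = (x \o lmul (mul := mul) b)%VF.
  by rewrite -IL IK.
have Jr a y : J (mul a (I_map r y)) = (y \o rmul (mul := mul) a)%VF.
  by rewrite -IR IK.
have JPhi k a : J (Phi k a) = (J a \o Psi k)%VF.
  by rewrite -{1}[a]JK -(I_map_intertwine _ _ _ (PsiPhi k) (PhiPsi k)) IK.
have PE a : P a = - lambda *: r_plus r (J a) by rewrite scale_lfunE comp_lfunE.
have Bsym a b : B a b = B b a by rewrite /B -/J Jsym.
have B_nondeg a : (forall b, B a b = 0) -> a = 0.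
  move=> Ba; rewrite -[a]JK -(linear0 (I_map r)); congr (I_map r _).
  apply/lfunP => b; apply/eqP; have /eqP := Ba b.
  by rewrite mulf_eq0 oppr_eq0 (negPf nz_l) zero_lfunE.
split; last by move=> k a b; rewrite /B -/J JPhi comp_lfunE.
(* This closes the differential algebra axioms, left nondegeneracy and symmetry. *)
split => //.
- split=> [b k a a' | a k b b']; rewrite /B -/J linearP /=.
    by rewrite add_lfunE scale_lfunE mulrDr mulrCA.
  by rewrite mulrDr mulrCA.
- by move=> b Bb; apply: B_nondeg => a; rewrite Bsym.
- move=> a b c; rewrite /B -/J; congr (_ * _).
  by rewrite -{1}[a]JK Jl comp_lfunE lmulE.
- move=> a b; rewrite !PE.
  set x := J a; set y := J b; set p := r_plus r; set n := r_minus r.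
  have mulZl k c d : mul (k *: c) d = k *: mul c d.
    exact: (GRing.scalable_linear (mul_bilin.1 d)).
  have mulZr k c d : mul c (k *: d) = k *: mul c d.
    exact: (GRing.scalable_linear (mul_bilin.2 c)).
  have Jpl : J (mul (p x) b) = (y \o rmul (mul := mul) (p x))%VF.
    by rewrite -Jr JK.
  have Jpr c : J (mul a c) = (x \o lmul (mul := mul) c)%VF.
    by rewrite -Jl JK.
  (* As [b = p y - n y], the weight term splits; its [p y] part will cancel the term coming from
     [mul a (P b)], leaving the argument of [r_plus] in [AYBE_r_plus]. *)
  have Jab : J (mul a b) = J (mul a (p y)) - J (mul a (n y)).
    by rewrite -linearB -!(lmulE mul_bilin) -linearB -I_mapE JK.
  have -> : J (mul (- lambda *: p x) b + mul a (- lambda *: p y)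
             + lambda *: mul a b)
          = - lambda *: ((x \o lmul (mul := mul) (n y))%VF
                         + (y \o rmul (mul := mul) (p x))%VF).
    rewrite mulZl mulZr !linearD !linearZ /= Jab !Jpr Jpl scalerBr !scaleNr.
    by rewrite addrA subrK addrC.
  rewrite linearZ /= -(AYBE_r_plus mul_bilin r aybe).
  by rewrite mulZl mulZr.
- move=> a b; rewrite /B -/J (Jsym (P a)) !PE !linearZ /=.
  (* Expanding [b] as [I_map r (J b)] gives [J a b = u + v], where [u] is [J a (r_plus r (J b))] and
     [v] is [J b (r_plus r (J a))]; the three terms then cancel. *)
  rewrite -[X in lambda * (_ * J a X)]JK I_mapE linearB /= r_minus_adjoint.
  rewrite -![_ *: _]/(_ * _); move: (J a _) (J b _) => u v.
  by ring.
- move=> k a; rewrite !PE linearZ /= JPhi.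
  by rewrite (r_plus_intertwine _ _ _ (PsiPhi k)).
Qed.
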